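(* Assume that $\mathcal{L}_{\min,\mathcal{M}}$ is finite, that $\mathcal{L}$ is restricted $L$-smooth and satisfies the strong $\lambda$-Polyak-Łojasiewicz condition, that the retraction error is controlled with constant $C_{\mathrm R}$ and perturbations $\beta_t\ge0$, and that the estimators $P_t^n$, which at each step $t\ge0$ are built from points $x_1,\dots,x_n$ drawn i.i.d. from $\mu_t$ given $\mathcal{F}_t$, have bounded bias and variance with $c_{\mathrm{bias},2}=0$. Define $$\sigma_t:=c_{\mathrm{bias},1}s_t-s_t^2\tfrac{L+C_{\mathrm R}}2c_{\mathrm{var},1},\qquad a_t:=1-2\lambda\sigma_t .$$ If $\sigma_t>0$, then $$\mathbb{E}[\mathcal{L}(u_{t+1})-\mathcal{L}_{\min,\mathcal{M}}\mid\mathcal{F}_t]\le a_t\big(\mathcal{L}(u_t)-\mathcal{L}_{\min,\mathcal{M}}\big)+s_t^2\tfrac{L+C_{\mathrm R}}2c_{\mathrm{var},2}\|(I-P_t)g_t\|^2+\beta_t .$$ Moreover, suppose $\sigma_t>0$ for all $t$, let $(\xi_t)\in\ell^1$ and assume that the step sizes satisfy $$s_t^2\tfrac{L+C_{\mathrm R}}2c_{\mathrm{var},2}\|(I-P_t)g_t\|^2+\beta_t\le\xi_t .$$ Then for any deterministic sequence $\chi_t\ge0$ for which there is $T\in\mathbb{N}$ with $a_t\chi_{t+1}\le\chi_t$ for all $t\ge T$, and for which $(\chi_{t+1}\xi_t)_t\in\ell^1$, it holds almost surely that $$\mathcal{L}(u_t)-\mathcal{L}_{\min,\mathcal{M}}\lesssim\chi_t^{-1},$$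 i.e. almost surely there is a finite (random) constant $C$ with $\mathcal{L}(u_t)-\mathcal{L}_{\min,\mathcal{M}}\le C\chi_t^{-1}$ for all $t$ (with $0^{-1}=\infty$).
   Context: Setting. $\mathcal{X}$ is a set with probability measure $\rho$, $\mathcal{H}$ is a Hilbert space of functions on $\mathcal{X}$ with inner product $(\cdot,\cdot)$ and norm $\|\cdot\|$, $\mathcal{L}:\mathcal{H}\to\mathbb{R}$, $\mathcal{L}(v)=\int \ell(v;x)\,d\rho(x)$ is the expected loss of a loss function $\ell:\mathcal{H}\times\mathcal{X}\to\mathbb{R}$, $\mathcal{M}\subseteq\mathcal{H}$ is a (possibly nonlinear) model class, and $\mathcal{L}_{\min,\mathcal{M}}:=\inf_{u\in\mathcal{M}}\mathcal{L}(u)$. $(\Omega,\Sigma,\mathbb{P},(\mathcal{F}_t)_{t\ge0})$ is a filtered probability space. Algorithm. Given an $\mathcal{F}_0$-measurable $u_0\in\mathcal{M}$, define for $t\ge0$ $$g_t:=\nabla\mathcal{L}(u_t),\qquad \bar u_{t+1}:=u_t-s_tP_t^ng_t,\qquad u_{t+1}:=R_t(\bar u_{t+1}).$$ Here $\mathcal{L}$ is Fréchet differentiable at $u_t$ and $\nabla\mathcal{L}(u_t)\in\mathcal{H}$ is the Riesz representative of the derivative; $\mathcal{T}_t\subseteq\mathcal{H}$ is an $\mathcal{F}_t$-measurable linear space of finite dimension $d_t$ associated with $u_t$; $P_t:\mathcal{H}\to\mathcal{T}_t$ is the $\mathcal{H}$-orthogonal projection; $P_t^n$ is a random operator with values in $\mathcal{T}_t$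 (an estimator of $P_t$), built from $n$ sample points drawn at step $t$ conditionally on $\mathcal{F}_t$ from an $\mathcal{F}_t$-dependent probability measure $\mu_t$ on $\mathcal{X}$, so that $u_{t+1}$ is $\mathcal{F}_{t+1}$-measurable; the step size $s_t>0$ is $\mathcal{F}_t$-measurable; the retraction $R_t:\mathcal{H}\to\mathcal{M}$ is $\mathcal{F}_t$-measurable. All (conditional) expectations that appear are assumed to exist. Restricted $L$-smoothness: $L>0$ and for all $u_t\in\mathcal{M}$ with associated $\mathcal{T}_t$ and all $g\in\mathcal{T}_t$, $\mathcal{L}(u_t+g)\le\mathcal{L}(u_t)+(\nabla\mathcal{L}(u_t),g)+\frac L2\|g\|^2$. Strong $\lambda$-Polyak-Łojasiewicz condition: $\lambda>0$ and for all $u_t\in\mathcal{M}$ with associated $\mathcal{T}_t$, $\|P_t\nabla\mathcal{L}(u_t)\|^2\ge2\lambda(\mathcal{L}(u_t)-\mathcal{L}_{\min,\mathcal{M}})$. Controlled retraction error with $C_{\mathrm R}>0$ and nonnegative, $\mathcal{F}_t$-measurable $\beta_t$: for all $t$ and $g\in\mathcal{T}_t$, $\mathcal{L}(R_t(u_t+g))\le\mathcal{L}(u_t+g)+\frac{C_{\mathrm R}}2\|g\|^2+\beta_t$. Bounded bias and variance (case $c_{\mathrm{bias},2}=0$): $c_{\mathrm{bias},1},c_{\mathrm{var},1}>0$, $c_{\mathrm{var},2}\ge0$, and for every $t$ and every $\mathcal{F}_t$-measurable $\mathcal{H}$-valued $g$, $\mathbb{E}[(g,P_t^ng)\mid\mathcal{F}_t]\ge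 c_{\mathrm{bias},1}\|P_tg\|^2$ and $\mathbb{E}[\|P_t^ng\|^2\mid\mathcal{F}_t]\le c_{\mathrm{var},1}\|P_tg\|^2+c_{\mathrm{var},2}\|(I-P_t)g\|^2$. *)

(* Defs.v *)
From HB Require Import structures.
From mathcomp Require Import all_boot all_order all_algebra sesquilinear.
From mathcomp Require Import all_classical all_reals all_analysis.
From mathcomp Require Import measurable_realfun.

Set Implicit Arguments.
Unset Strict Implicit.
Unset Printing Implicit Defensive.

Import Order.TTheory GRing.Theory Num.Theory.
Import numFieldNormedType.Exports.

Local Open Scope classical_set_scope.
Local Open Scope ring_scope.

(* A real Hilbert space is a complete normed module H with a form
   dot : {dot H for idfun} (symmetric, bilinear, positive definite) that
   induces the norm. *)
Definition norm_from_dot (R : realType) (H : completeNormedModType R)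
    (dot : {dot H for idfun}) : Prop :=
  forall v : H, `|v| ^+ 2 = dot v v.

Definition subspace_of_dim (R : realType) (H : completeNormedModType R)
    (V : set H) (k : nat) : Prop :=
  exists b : 'I_k -> H,
    (forall a : 'I_k -> R, \sum_(i < k) a i *: b i = 0 -> forall i, a i = 0) /\
    V = [set \sum_(i < k) a i *: b i | a in [set: 'I_k -> R]].

(* The choice operator get is meaningful here when v has a projection onto V,
   in particular when V is a finite-dimensional subspace. *)
Definition orthproj (R : realType) (H : completeNormedModType R)
    (dot : {dot H for idfun}) (V : set H) (v : H) : H :=
  get [set p | V p /\ forall w, V w -> dot (v - p) w = 0].

(* Riesz representative of the Frechet derivative; meaningful when L is
   differentiable at u. *)
Definition gradient (R : realType) (H : completeNormedModType R)
    (dot : {dot H for idfun}) (L : H -> R) (u : H) : H :=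
  get [set g | forall h, 'd (L : H -> R^o) u h = dot g h].

Notation borel H := (g_sigma_algebraType (@open H)).

Definition measurable_wrt d d' (Omega : measurableType d)
    (Y : measurableType d') (G : set (set Omega)) (f : Omega -> Y) : Prop :=
  measurable_fun [set: g_sigma_algebraType G] (f : g_sigma_algebraType G -> Y).

Definition borel_measurable_wrt d (Omega : measurableType d)
    (H : ptopologicalType) (G : set (set Omega)) (f : Omega -> H) : Prop :=
  measurable_wrt G (f : Omega -> borel H).

Definition filtration d (Omega : measurableType d)
    (F : nat -> set (set Omega)) : Prop :=
  [/\ forall t, sigma_algebra [set: Omega] (F t),
      forall t, F t `<=` measurable &
      forall t, F t `<=` F t.+1].

Definition cond_exp_ge0 d (Omega : measurableType d) (R : realType)
    (P : probability Omega R) (G : set (set Omega))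
    (X Y : Omega -> \bar R) : Prop :=
  [/\ measurable_wrt G Y,
      (forall w, 0 <= Y w)%E &
      forall A, G A -> (\int[P]_(w in A) X w = \int[P]_(w in A) Y w)%E].

(* Y is a version of E[X | G].  X need not be integrable: E[X | G] exists as
   soon as E[X^+ | G] and E[X^- | G], which are always defined in [0, +oo],
   are almost surely not both infinite.  For integrable X this is the usual
   notion. *)
Definition is_cond_exp d (Omega : measurableType d) (R : realType)
    (P : probability Omega R) (G : set (set Omega))
    (X Y : Omega -> \bar R) : Prop :=
  [/\ measurable_fun [set: Omega] X,
      measurable_wrt G Y &
      exists Yp Yn : Omega -> \bar R,
        [/\ cond_exp_ge0 P G X^\+%E Yp,
            cond_exp_ge0 P G X^\-%E Yn &
            \forall w \ae P,
              (Yp w < +oo \/ Yn w < +oo)%E /\ Y w = (Yp w - Yn w)%E]].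

Definition cond_iid d d' (Omega : measurableType d) (X : measurableType d')
    (R : realType) (P : probability Omega R) (G : set (set Omega)) (n : nat)
    (x : 'I_n -> Omega -> X) (mu : R.-pker g_sigma_algebraType G ~> X) : Prop :=
  (forall i, measurable_fun [set: Omega] (x i)) /\
  forall B : 'I_n -> set X, (forall i, measurable (B i)) ->
    is_cond_exp P G
      (fun w => (\1_(\bigcap_(i in [set: 'I_n]) x i @^-1` B i) w)%:E)
      (fun w => (\prod_(i < n) mu w (B i))%E).

(* Effros measurability of a random subset of H. *)
Definition set_measurable_wrt d (Omega : measurableType d)
    (H : topologicalType) (G : set (set Omega)) (V : Omega -> set H) : Prop :=
  forall U : set H, open U -> G [set w | V w `&` U !=set0].

Definition inf_on (R : realType) (H : Type) (L : H -> R) (M : set H) : \bar R :=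
  ereal_inf [set (L u)%:E | u in M].

(* In the next two definitions, assoc u V reads: V is the linear space (or one of
   the linear spaces) associated with u. *)
Definition restricted_smooth (R : realType) (H : completeNormedModType R)
    (dot : {dot H for idfun}) (L : H -> R) (M : set H)
    (assoc : H -> set H -> Prop) (Ls : R) : Prop :=
  0 < Ls /\
  forall u V, M u -> assoc u V -> forall g, V g ->
    L (u + g) <= L u + dot (gradient dot L u) g + Ls / 2 * `|g| ^+ 2.

Definition strong_PL (R : realType) (H : completeNormedModType R)
    (dot : {dot H for idfun}) (L : H -> R) (M : set H)
    (assoc : H -> set H -> Prop) (lam : R) : Prop :=
  0 < lam /\
  forall u V, M u -> assoc u V ->
    2 * lam * (L u - fine (inf_on L M)) <=
    `|orthproj dot V (gradient dot L u)| ^+ 2.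

Definition controlled_retraction d (Omega : measurableType d) (R : realType)
    (H : completeNormedModType R) (F : nat -> set (set Omega)) (L : H -> R)
    (u : nat -> Omega -> H) (V : nat -> Omega -> set H)
    (Rt : nat -> Omega -> H -> H) (CR : R) (beta : nat -> Omega -> R) : Prop :=
  [/\ 0 < CR,
      forall t w, 0 <= beta t w,
      forall t, measurable_wrt (F t) (beta t) &
      forall t w g, V t w g ->
        L (Rt t w (u t w + g)) <=
        L (u t w + g) + CR / 2 * `|g| ^+ 2 + beta t w].

(* Bounded bias and variance with vanishing second bias constant. *)
Definition bounded_bias_variance d (Omega : measurableType d) (R : realType)
    (P : probability Omega R) (H : completeNormedModType R)
    (dot : {dot H for idfun}) (F : nat -> set (set Omega))
    (V : nat -> Omega -> set H) (Pn : nat -> Omega -> H -> H)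
    (cbias1 cvar1 cvar2 : R) : Prop :=
  [/\ 0 < cbias1, 0 < cvar1, 0 <= cvar2 &
  forall t (g : Omega -> H), borel_measurable_wrt (F t) g ->
    (exists Y, is_cond_exp P (F t) (fun w => (dot (g w) (Pn t w (g w)))%:E) Y /\
       \forall w \ae P,
         ((cbias1 * `|orthproj dot (V t w) (g w)| ^+ 2)%:E <= Y w)%E) /\
    (exists Y, is_cond_exp P (F t) (fun w => (`|Pn t w (g w)| ^+ 2)%:E) Y /\
       \forall w \ae P,
         (Y w <= (cvar1 * `|orthproj dot (V t w) (g w)| ^+ 2 +
                  cvar2 * `|g w - orthproj dot (V t w) (g w)| ^+ 2)%:E)%E)].

Definition sigma_rate (R : realType) (cbias1 cvar1 Ls CR s : R) : R :=
  cbias1 * s - s ^+ 2 * ((Ls + CR) / 2) * cvar1.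

Definition decay_factor (R : realType) (lam sigma : R) : R :=
  1 - 2 * lam * sigma.

Definition ell1 (R : realType) (a : nat -> R) : Prop := cvgn [normed series a].

(* Main.v *)
Require Import Defs.
From HB Require Import structures.
From mathcomp Require Import all_boot all_order all_algebra sesquilinear.
From mathcomp Require Import all_classical all_reals all_analysis.
From mathcomp Require Import measurable_realfun.
From mathcomp Require Import lra.

Set Implicit Arguments.
Unset Strict Implicit.
Unset Printing Implicit Defensive.

Import Order.TTheory GRing.Theory Num.Theory.
Import numFieldNormedType.Exports.

Local Open Scope classical_set_scope.
Local Open Scope ring_scope.

(** Two ingredients give the theorem.

    One step.  The next iterate retracts u - s p, where p is the estimated
    projection of the gradient g and lies in the linear space attached to u.
    Restricted smoothness and the retraction bound combine into the pointwise
    inequality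
      X + s (g, p) <= e + beta + c s^2 |p|^2,    c = (Ls + CR) / 2,
    between the current excess loss e and the next one, X
    ([retracted_step_le]).  Taking conditional expectations
    ([cond_exp_descent]), bounding (g, p) from below by the bias condition and
    |p|^2 from above by the variance condition turns the terms in |P_t g|^2
    into - sigma |P_t g|^2, and the Polyak-Lojasiewicz condition converts this
    into the contraction factor 1 - 2 lam sigma.  The scalar product (g, p)
    need not be integrable, so it is split into its positive and negative
    parts, one on each side of the inequality.  Everything then happens between
    nonnegative functions, for which conditional expectations in [0, +oo] are
    additive, monotone, and commute with nonnegative factors that are
    measurable for the conditioning sigma-algebra ([cond_exp_ge0D],
    [cond_exp_ge0_le], [cond_exp_ge0M]).

    The rate.  Put W_t = chi_t e_t.  The condition a_t chi_{t+1} <= chi_t makes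
    W an almost supermartingale,
      E[W_{t+1} | F_t] <= W_t + eta_t,   eta_t = chi_{t+1} (E_t - a_t e_t)^+,
    and eta_t <= chi_{t+1} xi_t is almost surely summable.  This eta_t replaces
    the noise term because it is visibly F_t-measurable, whereas the
    measurability of the distance from g_t to a random subspace is delicate
    in a nonseparable space.  The claimed rate only asks that W be almost
    surely bounded, so no convergence theorem is involved: a maximal inequality
    of Doob type ([almost_supermartingale_maximal]) shows that, where W_0 and
    the sum of eta are at most m, the process W reaches a level K with
    probability at most 2m / K.  Let K, then m, tend to infinity
    ([almost_supermartingale_bounded]). *)

(** * Measurability with respect to a sub-sigma-algebra *)

Lemma measurable_wrt_preimage d d' (Omega : measurableType d)
    (Y : measurableType d') (G : set (set Omega)) (f : Omega -> Y) :
  sigma_algebra [set: Omega] G -> measurable_wrt G f ->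
  forall B, measurable B -> G (f @^-1` B).
Proof.
move=> sG mf B mB.
have := mf measurableT B mB.
by rewrite setTI /measurable /= (sigma_algebra_id sG).
Qed.

Lemma measurable_wrt_set d (Omega : measurableType d) (G : set (set Omega))
    (A : set Omega) : sigma_algebra [set: Omega] G ->
  (measurable (A : set (g_sigma_algebraType G)) <-> G A).
Proof. by move=> sG; rewrite /measurable /= (sigma_algebra_id sG). Qed.

Lemma measurable_wrtW d d' (Omega : measurableType d)
    (Y : measurableType d') (G : set (set Omega)) (f : Omega -> Y) :
  sigma_algebra [set: Omega] G -> G `<=` measurable ->
  measurable_wrt G f -> measurable_fun [set: Omega] f.
Proof.
move=> sG Gm mf _ B mB; rewrite setTI; apply: Gm.
exact: measurable_wrt_preimage.
Qed.

Lemma measurable_wrt_sub d d' (Omega : measurableType d)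
    (Y : measurableType d') (G G' : set (set Omega)) (f : Omega -> Y) :
  sigma_algebra [set: Omega] G -> sigma_algebra [set: Omega] G' ->
  G `<=` G' -> measurable_wrt G f -> measurable_wrt G' f.
Proof.
move=> sG sG' GG' mf _ B mB; rewrite setTI.
by apply/(measurable_wrt_set _ sG')/GG'; exact: measurable_wrt_preimage mB.
Qed.

Lemma sigma_algebra_setI d (Omega : measurableType d)
    (G : set (set Omega)) (A B : set Omega) :
  sigma_algebra [set: Omega] G -> G A -> G B -> G (A `&` B).
Proof.
move=> sG /(measurable_wrt_set _ sG) mA /(measurable_wrt_set _ sG) mB.
by apply/(measurable_wrt_set _ sG); exact: measurableI.
Qed.

(** * Conditional expectations of nonnegative functions *)

Section conditional_expectation_ge0.
Local Open Scope ereal_scope.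
Import HBNNSimple.

Lemma cond_exp_ge0_self d (Omega : measurableType d) (R : realType)
    (P : probability Omega R) (G : set (set Omega)) (Y : Omega -> \bar R) :
  measurable_wrt G Y -> (forall w, 0 <= Y w) -> cond_exp_ge0 P G Y Y.
Proof. by move=> mY Y0; split. Qed.

Lemma cond_exp_ge0D d (Omega : measurableType d) (R : realType)
    (P : probability Omega R) (G : set (set Omega))
    (X1 X2 Y1 Y2 : Omega -> \bar R) :
  sigma_algebra [set: Omega] G -> G `<=` measurable ->
  measurable_fun [set: Omega] X1 -> (forall w, 0 <= X1 w) ->
  measurable_fun [set: Omega] X2 -> (forall w, 0 <= X2 w) ->
  cond_exp_ge0 P G X1 Y1 -> cond_exp_ge0 P G X2 Y2 ->
  cond_exp_ge0 P G (fun w => X1 w + X2 w) (fun w => Y1 w + Y2 w).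
Proof.
move=> sG Gm mX1 X10 mX2 X20 [mY1 Y10 XY1] [mY2 Y20 XY2]; split.
- exact: emeasurable_funD.
- by move=> w; exact: adde_ge0.
- move=> A GA; have mA := Gm _ GA.
  have mY1' := measurable_wrtW sG Gm mY1.
  have mY2' := measurable_wrtW sG Gm mY2.
  rewrite !ge0_integralD//; [by rewrite XY1// XY2| | | |];
    exact: measurable_funTS.
Qed.

(** The building block of [cond_exp_ge0M]: an indicator of a set of G only
    shrinks the domain of integration to another set of G. *)
Lemma cond_exp_ge0_indic d (Omega : measurableType d) (R : realType)
    (P : probability Omega R) (G : set (set Omega)) (r : R) (B : set Omega)
    (X Y : Omega -> \bar R) :
  sigma_algebra [set: Omega] G -> G `<=` measurable ->
  measurable_fun [set: Omega] X -> (forall w, 0 <= X w) ->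
  cond_exp_ge0 P G X Y -> (0 <= r)%R -> G B ->
  forall A, G A -> \int[P]_(w in A) ((r * \1_B w)%:E * X w) =
                   \int[P]_(w in A) ((r * \1_B w)%:E * Y w).
Proof.
move=> sG Gm mX X0 [mY Y0 XY] r0 GB A GA.
have mA := Gm _ GA; have mB := Gm _ GB.
have mY' := measurable_wrtW sG Gm mY.
have key (Z : Omega -> \bar R) : measurable_fun [set: Omega] Z ->
    (forall w, 0 <= Z w) -> \int[P]_(w in A) ((r * \1_B w)%:E * Z w) =
    r%:E * \int[P]_(w in A `&` B) Z w.
  move=> mZ Z0; rewrite integral_mkcondr -ge0_integralZl_EFin//.
  - apply: eq_integral => w _; rewrite EFinM -muleA; congr (_ * _).
    by rewrite epatch_indic/= muleC.
  - by move=> w _; apply: erestrict_ge0.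
  - by apply/measurable_funTS; apply/(measurable_restrictT _ _).1 => //;
      exact: measurable_funTS.
rewrite !key//; congr (_ * _); apply: XY; exact: sigma_algebra_setI.
Qed.

(** Approximate h from below by functions that are simple for G.  For each of
    these the identity is a finite sum of instances of [cond_exp_ge0_indic],
    and monotone convergence carries it to h. *)
Lemma cond_exp_ge0M d (Omega : measurableType d) (R : realType)
    (P : probability Omega R) (G : set (set Omega)) (h : Omega -> R)
    (X Y : Omega -> \bar R) :
  sigma_algebra [set: Omega] G -> G `<=` measurable ->
  measurable_wrt G h -> (forall w, (0 <= h w)%R) ->
  measurable_fun [set: Omega] X -> (forall w, 0 <= X w) ->
  cond_exp_ge0 P G X Y ->
  cond_exp_ge0 P G (fun w => (h w)%:E * X w) (fun w => (h w)%:E * Y w).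
Proof.
move=> sG Gm mh h0 mX X0 XY; have [mY Y0 _] := XY.
have mY' := measurable_wrtW sG Gm mY.
have mEh : measurable_fun [set: g_sigma_algebraType G] (EFin \o h).
  exact/measurable_EFinP.
split.
- exact: emeasurable_funM.
- by move=> w; rewrite mule_ge0// lee_fin.
move=> A GA; have mA := Gm _ GA.
pose h_ n := nnsfun_approx measurableT mEh n.
have Gh_ n r : G (h_ n @^-1` [set r]).
  by apply/(measurable_wrt_set _ sG); rewrite -[X in measurable X]setTI;
    exact: measurable_funP.
have mh_ n : measurable_fun [set: Omega] (h_ n : Omega -> R).
  by apply: (measurable_wrtW sG Gm); exact: measurable_funP.
have simple n (Z : Omega -> \bar R) : measurable_fun [set: Omega] Z ->
    (forall w, 0 <= Z w) ->
    \int[P]_(w in A) ((h_ n w)%:E * Z w) =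
    \sum_(r \in range (h_ n))
      \int[P]_(w in A) ((r * \1_(h_ n @^-1` [set r]) w)%:E * Z w).
  move=> mZ Z0; rewrite -ge0_integral_fsum//.
  - apply: eq_integral => w _; rewrite [in LHS]fimfunE -fsumEFin//.
    rewrite ge0_mule_fsuml//.
    by move=> r; rewrite EFinM nnfun_muleindic_ge0.
  - move=> r; apply: emeasurable_funM; last exact: measurable_funTS.
    apply/measurable_EFinP; apply: measurable_funM => //.
    by apply: measurable_indic; exact: Gm.
  - by move=> r w _; rewrite mule_ge0// EFinM nnfun_muleindic_ge0.
have approx (Z : Omega -> \bar R) : measurable_fun [set: Omega] Z ->
    (forall w, 0 <= Z w) ->
    \int[P]_(w in A) ((h w)%:E * Z w) =
    limn (fun n => \int[P]_(w in A) ((h_ n w)%:E * Z w)).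
  move=> mZ Z0; rewrite -monotone_convergence//.
  - apply: eq_integral => w _; apply/esym/cvg_lim => //.
    have hcvg : EFin \o h_ ^~ w @ \oo --> (h w)%:E.
      apply: (cvg_nnsfun_approx measurableT mEh) => // v _ /=.
      by rewrite lee_fin.
    (* Z w may be infinite.  The product is continuous at (h w, Z w) unless
       h w = 0, and then every approximation of h vanishes at w. *)
    have [hw0|hw0] := eqVneq (h w) 0%R; last first.
      apply: (cvgeM _ hcvg (cvg_cst (Z w))).
      have [Zfin|Zinf] := boolP (Z w \is a fin_num); first exact: mule_def_fin.
      by apply: mule_def_neq0_infty => //; rewrite eqe.
    rewrite hw0 mul0e (_ : (fun n => _) = cst 0); first exact: cvg_cst.
    apply/funext => n; rewrite (_ : h_ n w = 0%R) ?mul0e//.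
    apply/eqP; rewrite eq_le -lee_fin -[in X in _ <= X]hw0.
    apply/andP; split => //.
    have nd : nondecreasing_seq (fun n => (h_ n w)%:E).
      move=> i j ij; rewrite lee_fin.
      by have /lefP := nd_nnsfun_approx measurableT mEh ij; apply.
    have := ereal_nondecreasing_cvgn nd => /(cvg_lim (@ereal_hausdorff R)).
    rewrite (cvg_lim _ hcvg)// => ->; exact: ereal_sup_ubound.
  - by move=> n; apply: emeasurable_funM;
      [apply/measurable_EFinP/measurable_funTS|exact: measurable_funTS].
  - by move=> n w _; rewrite mule_ge0// lee_fin.
  - move=> w _ m n mn; rewrite lee_wpmul2r// lee_fin.
    by have /lefP := nd_nnsfun_approx measurableT mEh mn; apply.
rewrite !approx//; congr (limn _); apply/funext => n.
rewrite !simple//; apply: eq_fsbigr => r /set_mem[w _ <-].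
exact: (cond_exp_ge0_indic sG Gm).
Qed.

(** On the set of G where Y2 < Y1 and Y2 <= n, the integral of Y2 is finite,
    so that the hypothesis forces the positive function Y1 - Y2 to have
    integral zero there: that set is null, whatever n is. *)
Lemma ae_le_of_integral_le d (Omega : measurableType d) (R : realType)
    (P : probability Omega R) (G : set (set Omega)) (Y1 Y2 : Omega -> \bar R) :
  sigma_algebra [set: Omega] G -> G `<=` measurable ->
  measurable_wrt G Y1 -> (forall w, 0 <= Y1 w) ->
  measurable_wrt G Y2 -> (forall w, 0 <= Y2 w) ->
  (forall A, G A -> \int[P]_(w in A) Y1 w <= \int[P]_(w in A) Y2 w) ->
  \forall w \ae P, Y1 w <= Y2 w.
Proof.
move=> sG Gm mY1 Y10 mY2 Y20 Y12.
have mY1' := measurable_wrtW sG Gm mY1.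
have mY2' := measurable_wrtW sG Gm mY2.
pose A n := [set w | Y2 w < Y1 w /\ Y2 w <= n%:R%:E].
have GA n : G (A n).
  apply/(measurable_wrt_set _ sG).
  rewrite (_ : A n = [set w | Y2 w < Y1 w] `&` [set w | Y2 w <= n%:R%:E])//.
  apply: measurableI.
    by rewrite -[X in measurable X]setTI; exact: emeasurable_fun_lt.
  by rewrite -[X in measurable X]setTI; exact: emeasurable_fun_infty_c.
have key n : \forall w \ae P, ~ A n w.
  have mA := Gm _ (GA n).
  have Y2fin w : A n w -> Y2 w \is a fin_num.
    by move=> [_ Y2n]; rewrite ge0_fin_numE// (le_lt_trans Y2n)// ltry.
  have D0 w : A n w -> 0 <= Y1 w - Y2 w.
    by move=> Aw; rewrite sube_ge0 ?Y2fin//; case: Aw => /ltW.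
  have mD : measurable_fun (A n) (fun w => Y1 w - Y2 w).
    by apply: measurable_funTS; exact: emeasurable_funB.
  have I2 : \int[P]_(w in A n) Y2 w \is a fin_num.
    rewrite ge0_fin_numE; last exact: integral_ge0.
    apply: (@le_lt_trans _ _ (\int[P]_(w in A n) (cst n%:R%:E) w)).
      apply: ge0_le_integral => //; first exact: measurable_funTS.
      by move=> w Aw; exact: Aw.2.
    rewrite integral_cst// lte_mul_pinfty// ?lee_fin//.
    by rewrite (le_lt_trans (probability_le1 P mA))// ltry.
  have /eqP : \int[P]_(w in A n) (Y1 w - Y2 w) = 0.
    apply/eqP; rewrite eq_le integral_ge0// andbT.
    rewrite -(leeD2lE _ _ I2) adde0 -ge0_integralD//; last first.
      exact: measurable_funTS.
    rewrite (_ : \int[P]_(w in A n) (Y2 w + (Y1 w - Y2 w)) =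
        \int[P]_(w in A n) Y1 w).
      exact: Y12.
    apply: eq_integral => w /set_mem Aw; rewrite addeC subeK// Y2fin//.
  move=> /eqP I0.
  have : ae_eq P (A n) (fun w => Y1 w - Y2 w) (cst 0).
    apply/ae_eq_integral_abs => //; rewrite -[RHS]I0.
    by apply: eq_integral => w /set_mem Aw; rewrite gee0_abs// D0.
  apply: filterS => w /= Aw0 Aw; have /eqP := Aw0 Aw.
  by apply/negP; rewrite gt_eqF// sube_gt0; case: Aw.
have := ae_foralln key; apply: filterS => w nA.
rewrite leNgt; apply/negP => Y21.
have Y2fin : Y2 w \is a fin_num.
  by rewrite ge0_fin_numE// (lt_le_trans Y21)// leey.
apply: (nA (Num.truncn (fine (Y2 w))).+1); split => //.
by rewrite -(fineK Y2fin) lee_fin ltW// truncnS_gt.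
Qed.

Lemma cond_exp_ge0_le d (Omega : measurableType d) (R : realType)
    (P : probability Omega R) (G : set (set Omega))
    (X1 X2 Y1 Y2 : Omega -> \bar R) :
  sigma_algebra [set: Omega] G -> G `<=` measurable ->
  measurable_fun [set: Omega] X1 -> (forall w, 0 <= X1 w) ->
  measurable_fun [set: Omega] X2 -> (forall w, X1 w <= X2 w) ->
  cond_exp_ge0 P G X1 Y1 -> cond_exp_ge0 P G X2 Y2 ->
  \forall w \ae P, Y1 w <= Y2 w.
Proof.
move=> sG Gm mX1 X10 mX2 X12 [mY1 Y10 XY1] [mY2 Y20 XY2].
apply: (ae_le_of_integral_le sG Gm) => // A GA; rewrite -XY1// -XY2//.
by apply: ge0_le_integral => //; [exact: Gm|exact: measurable_funTS..].
Qed.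

(** For a nonnegative X, the conditional expectation of the negative part
    vanishes almost surely, which reduces the general notion to the
    nonnegative one. *)
Lemma is_cond_exp_ge0 d (Omega : measurableType d) (R : realType)
    (P : probability Omega R) (G : set (set Omega)) (X Y : Omega -> \bar R) :
  sigma_algebra [set: Omega] G -> G `<=` measurable ->
  (forall w, 0 <= X w) -> is_cond_exp P G X Y ->
  exists2 Z, cond_exp_ge0 P G X Z & \forall w \ae P, Y w = Z w.
Proof.
move=> sG Gm X0 [mX mY [Yp [Yn [XYp XYn YE]]]].
exists Yp.
  move: XYp; rewrite (_ : X^\+ = X)//; apply/funext => w.
  by rewrite funeposE max_l.
have [mYn Yn0 _] := XYn.
have Yn_le : \forall w \ae P, Yn w <= 0.
  have zero : cond_exp_ge0 P G (cst 0) (cst 0).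
    by apply: cond_exp_ge0_self => //; exact: measurable_cst.
  apply: (cond_exp_ge0_le sG Gm _ _ _ _ XYn zero) => //.
  - exact: measurable_funeneg.
  - by move=> w; rewrite funenegE max_r// leeNl oppe0.
apply: filterS2 YE Yn_le => w [_ ->] Ynle.
have -> : Yn w = 0 by apply/eqP; rewrite eq_le Ynle Yn0.
by rewrite sube0.
Qed.
End conditional_expectation_ge0.

(** * Almost supermartingales *)

Lemma integral_le_cst d (Omega : measurableType d) (R : realType)
    (P : probability Omega R) (A : set Omega) (f : Omega -> \bar R) (m : R) :
  (0 <= m)%R -> measurable A -> measurable_fun [set: Omega] f ->
  (forall w, 0 <= f w)%E -> (forall w, A w -> f w <= m%:E)%E ->
  (\int[P]_(w in A) f w <= m%:E)%E.
Proof.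
move=> m0 mA mf f0 fm.
apply: (@le_trans _ _ (\int[P]_(w in A) (cst m%:E) w)%E).
  by apply: ge0_le_integral => //; exact: measurable_funTS.
by rewrite integral_cst// -[leRHS]mule1 lee_pmul ?probability_le1// lee_fin.
Qed.

Section almost_supermartingale.
Local Open Scope ereal_scope.

(** The inequality E[W_{t+1} | F_t] <= W_t + eta_t of Robbins and Siegmund,
    integrated over the events of F_t.  In this form it makes sense in
    [0, +oo], without integrability of W or eta. *)
Definition almost_supermartingale d (Omega : measurableType d) (R : realType)
    (P : probability Omega R) (F : nat -> set (set Omega))
    (W eta : nat -> Omega -> \bar R) : Prop :=
  [/\ forall t, measurable_wrt (F t) (W t),
      forall t, measurable_wrt (F t) (eta t),
      forall t w, 0 <= W t w,
      forall t w, 0 <= eta t w &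
      forall t A, F t A ->
        \int[P]_(w in A) W t.+1 w <= \int[P]_(w in A) (W t w + eta t w)].

(** The sum runs up to the last index at which D holds, and the full sum up
    to that index is at most m. *)
Lemma stopped_sum_le (R : realType) (e : nat -> \bar R) (D : nat -> bool)
    (m : \bar R) (N : nat) : 0 <= m ->
  (forall t, D t.+1 -> D t) ->
  (forall t, D t -> \sum_(k < t.+1) e k <= m) ->
  \sum_(t < N) (if D t then e t else 0) <= m.
Proof.
move=> m0 Ddec Dm.
have Dle t k : (k <= t)%N -> D t -> D k.
  elim: t => [|t IH]; first by rewrite leqn0 => /eqP ->.
  by rewrite leq_eqVlt => /predU1P[->//|]; rewrite ltnS => kt /Ddec; exact: IH.
elim: N => [|N IH]; first by rewrite big_ord0.
have [DN|nDN] := boolP (D N); last by rewrite big_ord_recr/= (negbTE nDN) adde0.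
rewrite (eq_bigr (fun t : 'I_N.+1 => e t)) ?Dm// => -[t /= tN] _.
by rewrite (Dle N t).
Qed.

(** D t is the event that the process still runs at time t.  On D t, either
    W jumps to K or above, which costs at least K times the probability of the
    jump, or the process goes on inside D t.+1; the mean of W over the running
    event pays for both and receives only eta.  Keeping eta as a separate sum
    avoids subtracting possibly infinite quantities. *)
Lemma stopped_energy_le d (Omega : measurableType d) (R : realType)
    (P : probability Omega R) (F : nat -> set (set Omega))
    (W eta : nat -> Omega -> \bar R) (K : R) (D : nat -> set Omega) :
  filtration F -> almost_supermartingale P F W eta -> (0 <= K)%R ->
  (forall t, F t (D t)) -> (forall t, D t.+1 `<=` D t) ->
  (forall t w, D t.+1 w -> W t.+1 w < K%:E) ->
  forall N,
  K%:E * \sum_(t < N) P (D t `&` [set w | K%:E <= W t.+1 w]) +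
    \int[P]_(w in D N) W N w <=
  \int[P]_(w in D 0%N) W 0%N w + \sum_(t < N) \int[P]_(w in D t) eta t w.
Proof.
move=> [sF Fm _] [mW meta W0 eta0 Wle] K0 FD Ddec DK.
have mW' t := measurable_wrtW (sF t) (Fm t) (mW t).
have meta' t := measurable_wrtW (sF t) (Fm t) (meta t).
have mD t := Fm t _ (FD t).
pose Ex t := D t `&` [set w | K%:E <= W t.+1 w].
have mEx t : measurable (Ex t).
  by apply: emeasurable_fun_c_infty => //; exact: measurable_funTS.
have step t : K%:E * P (Ex t) + \int[P]_(w in D t.+1) W t.+1 w <=
    \int[P]_(w in D t) W t w + \int[P]_(w in D t) eta t w.
  rewrite -ge0_integralD//; [|exact: measurable_funTS..].
  apply: le_trans (Wle _ _ (FD t)).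
  apply: (@le_trans _ _ (\int[P]_(w in Ex t `|` D t.+1) W t.+1 w)).
    rewrite ge0_integral_setU//; last 2 first.
    - exact: measurable_funTS.
    - apply/disj_setPS => w [[_ /= Kw] Dw].
      by have := lt_le_trans (DK _ _ Dw) Kw; rewrite ltxx.
    rewrite leeD2r//.
    rewrite -integral_cst//; apply: ge0_le_integral => //.
    - exact: measurable_funTS.
    - by move=> w [].
  apply: ge0_subset_integral => //; first exact: measurableU.
  - exact: measurable_funTS.
  - by move=> w [[]//|/Ddec].
elim=> [|N IH]; first by rewrite !big_ord0 mule0 add0e adde0.
rewrite !big_ord_recr/= ge0_muleDr ?measure_ge0 ?sume_ge0//.
rewrite -addeA.
apply: (@le_trans _ _ (K%:E * \sum_(t < N) P (Ex t) +
  (\int[P]_(w in D N) W N w + \int[P]_(w in D N) eta N w))).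
  by apply: leeD2l; exact: step.
by rewrite addeA [leRHS]addeA; apply: leeD2r; exact: IH.
Qed.

(** The process is stopped when it reaches K or when the accumulated eta
    exceeds m.  The energy available to [stopped_energy_le] is then at most m
    from W_0 and at most m from eta. *)
Lemma almost_supermartingale_maximal d (Omega : measurableType d)
    (R : realType) (P : probability Omega R) (F : nat -> set (set Omega))
    (W eta : nat -> Omega -> \bar R) (m K : R) :
  filtration F -> almost_supermartingale P F W eta -> (0 <= m)%R -> (m < K)%R ->
  exists B : set Omega, [/\ measurable B, P B <= ((m + m) / K)%:E &
    forall w, W 0%N w <= m%:E ->
      (forall t, \sum_(k < t) eta k w <= m%:E) ->
      (exists t, K%:E <= W t w) -> B w].
Proof.
move=> HF asm m0 mK; have K0 : (0 < K)%R by exact: le_lt_trans mK.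
have [sF Fm Finc] := HF; have [mW meta W0 eta0 _] := asm.
have Fle s t : (s <= t)%N -> F s `<=` F t.
  elim: t => [|t IH]; first by rewrite leqn0 => /eqP ->.
  rewrite leq_eqVlt => /predU1P[->//|]; rewrite ltnS => st.
  exact: subset_trans (IH st) (Finc t).
(* eta t is F t-measurable, so that the sum may include it and D t still
   belongs to F t. *)
pose D t := [set w | [/\ W 0%N w <= m%:E, \sum_(k < t.+1) eta k w <= m%:E &
  forall k, (k <= t)%N -> W k w < K%:E]].
have FD t : F t (D t).
  have mFt k : (k <= t)%N -> measurable_wrt (F t) (W k) /\
      measurable_wrt (F t) (eta k).
    by move=> kt; split; apply: (measurable_wrt_sub (sF k) (sF t) (Fle _ _ kt)).
  apply/(measurable_wrt_set _ (sF t)).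
  rewrite (_ : D t = [set w | W 0%N w <= m%:E] `&`
      [set w | \sum_(k < t.+1) eta k w <= m%:E] `&`
      \bigcap_(k < t.+1) [set w | W k w < K%:E]); last first.
    apply/seteqP; split => w /=.
      by move=> [? ? h]; do 2 split => //; move=> k /= kt; apply: h.
    by move=> [[? ?] h]; split => // k kt; apply: h.
  apply: measurableI; first apply: measurableI.
  - rewrite -[X in measurable X]setTI; apply: emeasurable_fun_infty_c => //.
    exact: (mFt 0%N _).1.
  - rewrite -[X in measurable X]setTI; apply: emeasurable_fun_infty_c => //.
    by apply: emeasurable_sum => k; apply: (mFt k _).2; rewrite -ltnS.
  - apply: bigcap_measurable => [|k kt]; first by exists 0%N.
    rewrite -[X in measurable X]setTI; apply: emeasurable_fun_infty_o => //.
    by apply: (mFt k _).1; rewrite -ltnS.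
have Ddec t : D t.+1 `<=` D t.
  move=> w [W0m Sm WK]; split => //; last by move=> k kt; apply/WK/leqW.
  by apply: le_trans Sm; rewrite [leRHS]big_ord_recr/= leeDl.
have DK t w : D t.+1 w -> W t.+1 w < K%:E by move=> [_ _]; apply.
have mD t := Fm t _ (FD t).
have mW' t := measurable_wrtW (sF t) (Fm t) (mW t).
have meta' t := measurable_wrtW (sF t) (Fm t) (meta t).
pose Ex t := D t `&` [set w | K%:E <= W t.+1 w].
have mEx t : measurable (Ex t).
  by apply: emeasurable_fun_c_infty => //; exact: measurable_funTS.
exists (\bigcup_t Ex t); split.
- exact: bigcup_measurable.
- have sumP N : \sum_(t < N) P (Ex t) <= ((m + m) / K)%:E.
    rewrite mulrC EFinM lee_pdivlMl//.
    have energy := stopped_energy_le HF asm (ltW K0) FD Ddec DK N.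
    apply: (le_trans (le_trans (leeDl _ _) energy)); first exact: integral_ge0.
    rewrite EFinD; apply: leeD.
      by apply: integral_le_cst => // w [].
    under eq_bigr do rewrite integral_mkcond.
    rewrite -ge0_integral_sum//.
    - apply: integral_le_cst => //.
      + apply: emeasurable_sum => t; apply/(measurable_restrictT _ _).1 => //.
        exact: measurable_funTS.
      + by move=> w; apply: sume_ge0 => t _; exact: erestrict_ge0.
      + move=> w _; rewrite /patch.
        apply: (@stopped_sum_le _ (eta ^~ w) (fun t => w \in D t)) => //.
        * by move=> t /set_mem Dw; apply/mem_set/Ddec.
        * by move=> t /set_mem[].
    - by move=> t; apply/(measurable_restrictT _ _).1 => //;
          exact: measurable_funTS.
    - by move=> t w _; exact: erestrict_ge0.
  apply: (@le_trans _ _ (\sum_(t <oo) P (Ex t))).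
    by apply: measure_sigma_subadditive => //; exact: bigcup_measurable.
  apply: lime_le; first exact: is_cvg_nneseries.
  by apply: nearW => N; rewrite big_mkord.
(* The first time at which W reaches K is positive because W 0 <= m < K, and
   just before it the process still runs. *)
- move=> w W0m Sm Kw; case: (ex_minnP Kw) => -[|t] Kt tmin.
    by move: (le_trans Kt W0m); rewrite lee_fin leNgt mK.
  exists t => //; split => //; split => // k kt.
  rewrite ltNge; apply/negP => /tmin.
  by rewrite ltnNge kt.
Qed.

(** Where W_0 and the sums of eta are at most m, an unbounded path reaches all
    levels K, an event of probability at most 2m / K for every K. *)
Lemma almost_supermartingale_bounded d (Omega : measurableType d)
    (R : realType) (P : probability Omega R) (F : nat -> set (set Omega))
    (W eta : nat -> Omega -> \bar R) :
  filtration F -> almost_supermartingale P F W eta ->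
  (forall w, W 0%N w < +oo) ->
  (\forall w \ae P, exists c : R, forall t, \sum_(k < t) eta k w <= c%:E) ->
  \forall w \ae P, exists C : R, forall t, W t w <= C%:E.
Proof.
move=> HF asm W0fin etafin.
have [_ _ W0 _ _] := asm.
have level (m : nat) : \forall w \ae P, W 0%N w <= m%:R%:E ->
    (forall t, \sum_(k < t) eta k w <= m%:R%:E) ->
    exists C : R, forall t, W t w <= C%:E.
  pose K (n : nat) : R := (m%:R + n.+1%:R)%R.
  have mK n : (m%:R < K n)%R by rewrite ltrDl.
  have K0 n : (0 < K n)%R by exact: le_lt_trans (mK n).
  have /choice[B Bprop] : forall n, exists B : set Omega,
      [/\ measurable B, P B <= ((m%:R + m%:R) / K n)%:E &
      forall w, W 0%N w <= m%:R%:E ->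
      (forall t, \sum_(k < t) eta k w <= m%:R%:E) ->
      (exists t, (K n)%:E <= W t w) -> B w].
    by move=> n; exact: (almost_supermartingale_maximal HF asm).
  have mB n : measurable (B n) by have [] := Bprop n.
  have mcapB : measurable (\bigcap_n B n) by exact: bigcap_measurable.
  exists (\bigcap_n B n); split => //.
    apply/eqP; rewrite eq_le measure_ge0 andbT leNgt; apply/negP => P0.
    have Pfin : P (\bigcap_n B n) \is a fin_num by exact: fin_num_measure.
    set p := fine (P (\bigcap_n B n)).
    have p0 : (0 < p)%R by rewrite fine_gt0// P0 ltey_eq Pfin.
    (* This n makes 2m / K n smaller than the supposed probability p. *)
    pose n := Num.truncn ((m%:R + m%:R) / p)%R.
    have : P (\bigcap_n B n) <= ((m%:R + m%:R) / K n)%:E.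
      have [_ Bn _] := Bprop n; apply: le_trans Bn.
      by apply: le_measure; rewrite ?inE//; exact: bigcap_inf.
    rewrite -(fineK Pfin) -/p lee_fin ler_pdivlMr// mulrC -ler_pdivlMr//.
    apply/negP; rewrite -ltNge (lt_le_trans (truncnS_gt _))// /K.
    by rewrite lerDr.
  move=> w /= nw n _; have [_ _] := Bprop n; apply.
  - by apply: contrapT => h; apply: nw => /h.
  - by apply: contrapT => h; apply: nw => _ /h.
  - apply: contrapT => h; apply: nw => _ _; exists (K n) => t.
    by rewrite leNgt; apply/negP => /ltW Kt; apply: h; exists t.
have := ae_foralln level; apply: filterS2 etafin => w [c etac] lev.
pose m := maxn (Num.truncn (fine (W 0%N w))).+1 (Num.truncn c).+1.
apply: (lev m) => [|t].
- rewrite -(@fineK _ (W 0%N w)) ?ge0_fin_numE// lee_fin.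
  by rewrite (le_trans (ltW (truncnS_gt _)))// ler_nat leq_maxl.
- apply: (le_trans (etac t)); rewrite lee_fin.
  by rewrite (le_trans (ltW (truncnS_gt _)))// ler_nat leq_maxr.
Qed.
End almost_supermartingale.

(** * Conditional expectation of a descent inequality *)

(** D has no sign and may fail to be integrable, so s D^- is moved to the right
    and all terms become nonnegative.  Afterwards, bD <= YD excludes
    E[D^- | G] = +oo and YQ <= bQ excludes E[Q | G] = +oo; the right-hand side
    is then finite, hence so is the left-hand side, and D^- can be moved
    back. *)
Lemma cond_exp_descent d (Omega : measurableType d) (R : realType)
    (P : probability Omega R) (G : set (set Omega))
    (X D Q ex beta s bD bQ : Omega -> R) (c : R) (E YD YQ : Omega -> \bar R) :
  sigma_algebra [set: Omega] G -> G `<=` measurable ->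
  measurable_wrt G ex -> measurable_wrt G beta -> measurable_wrt G s ->
  (forall w, 0 <= X w) -> (forall w, 0 <= ex w) -> (forall w, 0 <= beta w) ->
  (forall w, 0 < s w) -> (forall w, 0 <= Q w) -> 0 <= c ->
  (forall w, X w + s w * D w <= ex w + beta w + c * s w ^+ 2 * Q w) ->
  is_cond_exp P G (EFin \o X) E ->
  is_cond_exp P G (EFin \o D) YD -> is_cond_exp P G (EFin \o Q) YQ ->
  (\forall w \ae P, ((bD w)%:E <= YD w)%E) ->
  (\forall w \ae P, (YQ w <= (bQ w)%:E)%E) ->
  \forall w \ae P,
    (E w <= (ex w + beta w - s w * bD w + c * s w ^+ 2 * bQ w)%:E)%E.
Proof.
move=> sG Gm mex mbeta ms X0 ex0 beta0 s_gt0 Q0 c0 XDQ XE.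
move=> [mD mYD [Yp [Yn [DYp DYn YDE]]]] QYQ bDle bQle.
have s0 w := ltW (s_gt0 w).
have [mX _ _] := XE; have [mQ _ _] := QYQ.
have [|Z XZ EZ] := is_cond_exp_ge0 sG Gm _ XE.
  by move=> w; rewrite lee_fin.
have [|ZQ QZQ YQZ] := is_cond_exp_ge0 sG Gm _ QYQ.
  by move=> w; rewrite lee_fin.
have [mZ Z0 _] := XZ; have [mZQ ZQ0 _] := QZQ.
have [mYp Yp0 _] := DYp; have [mYn Yn0 _] := DYn.
have mcs : measurable_wrt G (fun w => c * s w ^+ 2).
  by apply: measurable_funM => //; exact: measurable_funX.
have cs0 w : 0 <= c * s w ^+ 2 by rewrite mulr_ge0// sqr_ge0.
have mDp := measurable_funepos mD; have mDn := measurable_funeneg mD.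
have Dp0 w : (0 <= (EFin \o D)^\+ w)%E by exact: funepos_ge0.
have Dn0 w : (0 <= (EFin \o D)^\- w)%E by exact: funeneg_ge0.
have cDp := cond_exp_ge0M sG Gm ms s0 mDp Dp0 DYp.
have cDn := cond_exp_ge0M sG Gm ms s0 mDn Dn0 DYn.
have Q0' w : (0 <= (EFin \o Q) w)%E by rewrite lee_fin.
have cQ := cond_exp_ge0M sG Gm mcs cs0 mQ Q0' QZQ.
have meb : measurable_wrt G (fun w => (ex w + beta w)%:E).
  by apply/measurable_EFinP; exact: measurable_funD.
have eb0 w : (0 <= (ex w + beta w)%:E)%E by rewrite lee_fin addr_ge0.
have ceb := cond_exp_ge0_self P meb eb0.
have mul0 (h : Omega -> R) (f : Omega -> \bar R) : (forall w, 0 <= h w) ->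
    (forall w, 0 <= f w)%E -> forall w, (0 <= (h w)%:E * f w)%E.
  by move=> h0 f0 w; rewrite mule_ge0// lee_fin.
have mmul (h : Omega -> R) (f : Omega -> \bar R) : measurable_wrt G h ->
    measurable_fun [set: Omega] f ->
    measurable_fun [set: Omega] (fun w => (h w)%:E * f w)%E.
  move=> /(measurable_wrtW sG Gm) mh mf.
  by apply: emeasurable_funM => //; exact/measurable_EFinP.
have X0' w : (0 <= (EFin \o X) w)%E by rewrite lee_fin.
have cL := cond_exp_ge0D sG Gm mX X0' (mmul _ _ ms mDp) (mul0 _ _ s0 Dp0)
  XZ cDp.
have cR1 := cond_exp_ge0D sG Gm (mmul _ _ ms mDn) (mul0 _ _ s0 Dn0)
  (mmul _ _ mcs mQ) (mul0 _ _ cs0 Q0') cDn cQ.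
have cR := cond_exp_ge0D sG Gm (measurable_wrtW sG Gm meb) eb0
  (emeasurable_funD (mmul _ _ ms mDn) (mmul _ _ mcs mQ))
  (fun w => adde_ge0 (mul0 _ _ s0 Dn0 w) (mul0 _ _ cs0 Q0' w)) ceb cR1.
have le_ae : \forall w \ae P, (Z w + (s w)%:E * Yp w <=
    (ex w + beta w)%:E + ((s w)%:E * Yn w + (c * s w ^+ 2)%:E * ZQ w))%E.
  apply: (cond_exp_ge0_le sG Gm _ _ _ _ cL cR).
  - by apply: emeasurable_funD => //; exact: mmul.
  - by move=> w; rewrite adde_ge0// mul0.
  - apply: emeasurable_funD; first exact: (measurable_wrtW sG Gm meb).
    by apply: emeasurable_funD; exact: mmul.
  - move=> w; rewrite funeposE funenegE /= -!EFin_max.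
    rewrite -!EFinM -!EFinD lee_fin.
    have := XDQ w; have [D0|D0] := leP 0 (D w).
      have D0' : - D w <= 0 by rewrite oppr_le0.
      by rewrite (max_r D0'); lra.
    have D0' : 0 <= - D w by rewrite oppr_ge0 ltW.
    by rewrite (max_l D0'); lra.
near=> w.
have -> : E w = Z w by near: w.
have := Z0 w; have := Yp0 w; have := Yn0 w; have := ZQ0 w.
have : (Z w + (s w)%:E * Yp w <=
    (ex w + beta w)%:E + ((s w)%:E * Yn w + (c * s w ^+ 2)%:E * ZQ w))%E.
  by near: w.
have : ((bD w)%:E <= Yp w - Yn w)%E.
  have [_ <-] : (Yp w < +oo \/ Yn w < +oo)%E /\ YD w = (Yp w - Yn w)%E.
    by near: w.
  by near: w.
have : (ZQ w <= (bQ w)%:E)%E.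
  have <- : YQ w = ZQ w by near: w.
  by near: w.
have sw := s_gt0 w; have csw := cs0 w.
case: (ZQ w) => // q; rewrite lee_fin => qb.
case: (Yn w) => // [yn|]; last by case: (Yp w).
case: (Yp w) => // [yp|_]; last first.
  by rewrite gt0_muley ?lte_fin//; case: (Z w).
rewrite -EFinB lee_fin => Db.
case: (Z w) => // z.
rewrite -!EFinM -!EFinD !lee_fin => zle _ _ _ _.
have : 0 <= s w * (yp - yn - bD w) by rewrite mulr_ge0 ?subr_ge0// ltW.
have : 0 <= c * s w ^+ 2 * (bQ w - q) by rewrite mulr_ge0 ?subr_ge0.
by rewrite !mulrBr; lra.
Unshelve. all: by end_near.
Qed.

(** * From a contraction in expectation to an almost sure rate *)

Lemma ell1_tail_sum_bounded (R : realType) (a : nat -> R) (T0 : nat) :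
  ell1 a -> exists c : R, forall t, \sum_(k < t) `|a (T0 + k)%N| <= c.
Proof.
move=> a1; exists (limn [normed series a]) => t.
apply: (@le_trans _ _ (\sum_(k < T0 + t) `|a k|)).
  by rewrite big_split_ord/= lerDr sumr_ge0.
have nd : nondecreasing_seq [normed series a].
  by apply: nondecreasing_series => k _ _ /=.
rewrite -(big_mkord xpredT (fun k => `|a k|)).
exact: (nondecreasing_cvgn_le nd a1).
Qed.

(** The process chi_t ex_t, started at T0, is an almost supermartingale with
    bounded sums of perturbations; its almost sure bound is the rate.  The
    finitely many times before T0 only enlarge the constant. *)
Lemma almost_supermartingale_rate d (Omega : measurableType d) (R : realType)
    (P : probability Omega R) (F : nat -> set (set Omega))
    (ex a xi : nat -> Omega -> R) (E : nat -> Omega -> \bar R)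
    (chi : nat -> R) :
  filtration F ->
  (forall t, measurable_wrt (F t) (ex t)) -> (forall t w, 0 <= ex t w) ->
  (forall t, measurable_wrt (F t) (a t)) ->
  (forall t, is_cond_exp P (F t) (EFin \o ex t.+1) (E t)) ->
  (forall t, \forall w \ae P, (E t w <= (a t w * ex t w + xi t w)%:E)%E) ->
  (forall t, \forall w \ae P, 0 <= xi t w) ->
  (forall t, 0 <= chi t) ->
  (exists T0 : nat, forall t, (T0 <= t)%N ->
     \forall w \ae P, a t w * chi t.+1 <= chi t) ->
  (\forall w \ae P, ell1 (fun t => chi t.+1 * xi t w)) ->
  \forall w \ae P, exists C : R, 0 < C /\
    forall t, ((ex t w)%:E <= C%:E * ((chi t)%:E)^-1)%E.
Proof.
move=> HF mex ex0 ma Econd Ele xi0 chi0 [T0 achi] chixi.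
have [sF Fm Finc] := HF.
have /choice[Z Zprop] : forall t, exists Z : Omega -> \bar R,
    cond_exp_ge0 P (F t) (EFin \o ex t.+1) Z /\ \forall w \ae P, E t w = Z w.
  move=> t; have [|Z ? ?] := is_cond_exp_ge0 (sF t) (Fm t) _ (Econd t).
    by move=> w; rewrite lee_fin.
  by exists Z.
pose W t w := (chi (T0 + t)%N * ex (T0 + t)%N w)%:E.
(* The positive part of D measures by how much the contraction fails.  It is
   measurable for F t, which is not known of xi t. *)
pose D t w := (Z t w - (a t w * ex t w)%:E)%E.
pose eta t w := ((chi (T0 + t).+1)%:E * (D (T0 + t)%N)^\+ w)%E.
have mex' t := measurable_wrtW (sF t) (Fm t) (mex t).
have mD t : measurable_wrt (F t) (D t).
  have [[mZ _ _] _] := Zprop t.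
  apply: emeasurable_funB => //; apply/measurable_EFinP.
  by apply: measurable_funM; [exact: ma|exact: mex].
have asm : almost_supermartingale P (fun t => F (T0 + t)%N) W eta.
  split.
  - move=> t; apply/measurable_EFinP; apply: measurable_funM => //.
    exact: mex.
  - move=> t; apply: emeasurable_funM => //.
    by apply: measurable_funepos; exact: mD.
  - by move=> t w; rewrite lee_fin mulr_ge0.
  - by move=> t w; rewrite mule_ge0 ?funepos_ge0// lee_fin.
  - move=> t A FA; have mA := Fm _ _ FA.
    have [[mZ Z0 ZE] _] := Zprop (T0 + t)%N.
    have mZ' := measurable_wrtW (sF _) (Fm _) mZ.
    rewrite /W addnS.
    under eq_integral do rewrite EFinM.
    rewrite ge0_integralZl_EFin//; last 2 first.
    + by move=> w _; rewrite lee_fin.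
    + by apply/measurable_EFinP/measurable_funTS.
    rewrite ZE// -ge0_integralZl_EFin//; last exact: measurable_funTS.
    apply: ae_ge0_le_integral => //.
    + by move=> w _; rewrite mule_ge0// lee_fin.
    + by apply: emeasurable_funM => //; exact: measurable_funTS.
    + by move=> w _; rewrite adde_ge0// ?lee_fin ?mulr_ge0// mule_ge0// lee_fin.
    + apply: emeasurable_funD.
        apply/measurable_EFinP/measurable_funM => //; exact: measurable_funTS.
      apply: emeasurable_funM => //; apply: measurable_funepos.
      by apply: measurable_funTS; exact: (measurable_wrtW (sF _) (Fm _) (mD _)).
    have := achi (T0 + t)%N (leq_addr _ _); apply: filterS => w aw _.
    rewrite /eta; set z := Z _ w.
    pose be := a (T0 + t)%N w * ex (T0 + t)%N w.
    have zle : (z <= be%:E + (D (T0 + t)%N)^\+ w)%E.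
      by rewrite -leeBlDl// funeposE le_max lexx.
    apply: le_trans (lee_wpmul2l _ zle) _; first by rewrite lee_fin.
    rewrite muleDr// ?fin_num_adde_defr//.
    rewrite leeD2r// -EFinM lee_fin /be mulrA ler_wpM2r// mulrC.
    exact: aw.
have HF' : filtration (fun t => F (T0 + t)%N).
  by split => t //; rewrite addnS; exact: Finc.
have W0fin w : (W 0%N w < +oo)%E by rewrite ltry.
have etafin : \forall w \ae P, exists c : R,
    forall t, (\sum_(k < t) eta k w <= c%:E)%E.
  have Zle t : \forall w \ae P,
      (Z t w <= (a t w * ex t w + xi t w)%:E)%E /\ 0 <= xi t w.
    have [_ EZ] := Zprop t; have := Ele t; have := xi0 t; move: EZ.
    by apply: filterS3 => w -> .
  have := ae_foralln Zle; apply: filterS2 chixi => w chixi_w Zw.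
  have [c cP] := ell1_tail_sum_bounded T0 chixi_w; exists c => t.
  move: (cP t); rewrite -lee_fin; apply: le_trans.
  rewrite -sumEFin; apply: lee_sum => k _; have [Zk xik] := Zw (T0 + k)%N.
  rewrite ger0_norm ?mulr_ge0// EFinM /eta lee_wpmul2l ?lee_fin//.
  rewrite funeposE ge_max lee_fin xik andbT /D.
  by rewrite leeBlDr// -EFinD addrC.
have := almost_supermartingale_bounded HF' asm W0fin etafin.
apply: filterS => w [C0 WC].
have S0 : 0 <= \sum_(k < T0) chi k * ex k w.
  by apply: sumr_ge0 => k _; rewrite mulr_ge0.
have C_gt0 : 0 < 1 + `|C0| + \sum_(k < T0) chi k * ex k w.
  by rewrite ltr_wpDr// ltr_wpDr.
exists (1 + `|C0| + \sum_(k < T0) chi k * ex k w); split => // t.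
have tC : chi t * ex t w <= 1 + `|C0| + \sum_(k < T0) chi k * ex k w.
  have [tT|Tt] := ltnP t T0.
    rewrite (bigD1 (Ordinal tT))//= addrCA lerDl addr_ge0//.
      by apply: sumr_ge0 => k _; rewrite mulr_ge0.
  have := WC (t - T0)%N; rewrite /W subnKC// lee_fin => h.
  have := ler_norm C0; lra.
(* Where chi t = 0, the bound is +oo. *)
have [chit0|chit0] := eqVneq (chi t) 0.
  by rewrite chit0 inve0 gt0_muley ?leey// lte_fin.
rewrite inver (negbTE chit0) -EFinM lee_fin ler_pdivlMr 1?mulrC//.
by rewrite lt_neqAle eq_sym chit0 chi0.
Qed.

(** * Retracted stochastic gradient steps *)

Lemma subspace_scale (R : realType) (H : completeNormedModType R) (V : set H)
    (k : nat) (a : R) (v : H) :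
  subspace_of_dim V k -> V v -> V (a *: v).
Proof.
move=> [b [_ ->]] [c _ <-]; exists (fun i => a * c i) => //.
by rewrite scaler_sumr; apply: eq_bigr => i _; rewrite scalerA.
Qed.

Lemma inf_on_le (R : realType) (H : Type) (L : H -> R) (M : set H) (v : H) :
  inf_on L M \is a fin_num -> M v -> fine (inf_on L M) <= L v.
Proof.
move=> infin Mv; rewrite -lee_fin (fineK infin).
by apply: ereal_inf_lbound; exists v.
Qed.

(** Smoothness and the retraction bound both apply to the increment - s p,
    which stays in the linear space V; their quadratic errors add up. *)
Lemma retracted_step_le (R : realType) (H : completeNormedModType R)
    (dot : {dot H for idfun}) (L : H -> R) (M : set H)
    (assoc : H -> set H -> Prop) (Ls CR beta s : R) (r : H -> H)
    (u p : H) (V : set H) (k : nat) :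
  restricted_smooth dot L M assoc Ls -> M u -> assoc u V ->
  subspace_of_dim V k -> V p ->
  (forall g, V g -> L (r (u + g)) <= L (u + g) + CR / 2 * `|g| ^+ 2 + beta) ->
  L (r (u - s *: p)) + s * dot (gradient dot L u) p <=
  L u + beta + (Ls + CR) / 2 * s ^+ 2 * `|p| ^+ 2.
Proof.
move=> [_ smooth] Mu uV Vdim Vp retr.
have Vsp : V (- (s *: p)) by rewrite -scaleNr; exact: subspace_scale Vdim Vp.
have := smooth _ _ Mu uV _ Vsp; have := retr _ Vsp.
have -> : dot (gradient dot L u) (- (s *: p)) =
    - (s * dot (gradient dot L u) p).
  by rewrite linearNr linearZr.
rewrite normrN normrZ exprMn real_normK ?num_real//.
lra.
Qed.

Theorem theorem4p9 (R : realType)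
  (dX : measure_display) (X : measurableType dX) (rho : probability X R)
  (H : completeNormedModType R) (dot : {dot H for idfun})
  (Hdot : norm_from_dot dot)
  (ell : H -> X -> R)
  (ell_int : forall v, rho.-integrable [set: X] (EFin \o ell v))
  (L : H -> R) (LE : forall v, L v = \int[rho]_x ell v x)
  (M : set H)
  (assoc : H -> set H -> Prop)
  (assoc_dim : forall u V, M u -> assoc u V -> exists k, subspace_of_dim V k)
  (L_diff : forall u V, M u -> assoc u V -> differentiable (L : H -> R^o) u)
  (dO : measure_display) (Omega : measurableType dO) (P : probability Omega R)
  (F : nat -> set (set Omega)) (HF : filtration F)
  (u : nat -> Omega -> H)
  (T : nat -> Omega -> set H)
  (T_assoc : forall t w, assoc (u t w) (T t w))
  (T_meas : forall t, set_measurable_wrt (F t) (T t))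
  (s : nat -> Omega -> R)
  (s_gt0 : forall t w, 0 < s t w)
  (s_meas : forall t, measurable_wrt (F t) (s t))
  (n : nat) (n_gt0 : (0 < n)%N)
  (mu : forall t, R.-pker g_sigma_algebraType (F t) ~> X)
  (x : nat -> 'I_n -> Omega -> X)
  (x_iid : forall t, cond_iid P (x t) (mu t))
  (est : nat -> Omega -> n.-tuple X -> H -> H)
  (est_meas : forall t v, measurable_fun
     [set: (g_sigma_algebraType (F t) * n.-tuple X)%type]
     (fun p : g_sigma_algebraType (F t) * n.-tuple X =>
        (est t p.1 p.2 v : borel H)))
  (Pn : nat -> Omega -> H -> H)
  (PnE : forall t w v, Pn t w v = est t w [tuple x t i w | i < n] v)
  (Pn_T : forall t w v, T t w (Pn t w v))
  (Rt : nat -> Omega -> H -> H)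
  (Rt_M : forall t w v, M (Rt t w v))
  (Rt_meas : forall t v, borel_measurable_wrt (F t) (fun w => Rt t w v))
  (u0_M : forall w, M (u 0%N w))
  (g : nat -> Omega -> H)
  (gE : forall t w, g t w = gradient dot L (u t w))
  (uS : forall t w,
     u t.+1 w = Rt t w (u t w - s t w *: Pn t w (g t w)))
  (u_meas : forall t, borel_measurable_wrt (F t) (u t))
  (g_meas : forall t, borel_measurable_wrt (F t) (g t))
  (Lu_meas : forall t, measurable_wrt (F t) (fun w => L (u t w)))
  (Lmin_fin : inf_on L M \is a fin_num)
  (Ls : R) (L_smooth : restricted_smooth dot L M assoc Ls)
  (lam : R) (L_PL : strong_PL dot L M assoc lam)
  (CR : R) (beta : nat -> Omega -> R)
  (R_contr : controlled_retraction F L u T Rt CR beta)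
  (cbias1 cvar1 cvar2 : R)
  (P_bbv : bounded_bias_variance P dot F T Pn cbias1 cvar1 cvar2)
  (* any version of the conditional expectation of the next excess loss *)
  (E : nat -> Omega -> \bar R)
  (E_cond : forall t, is_cond_exp P (F t)
     (fun w => (L (u t.+1 w) - fine (inf_on L M))%:E) (E t)) :
  let excess t w := L (u t w) - fine (inf_on L M) in
  let sigma t w := sigma_rate cbias1 cvar1 Ls CR (s t w) in
  let a t w := decay_factor lam (sigma t w) in
  let noise t w :=
    s t w ^+ 2 * ((Ls + CR) / 2) * cvar2 *
      `|g t w - orthproj dot (T t w) (g t w)| ^+ 2 + beta t w in
  (forall t, \forall w \ae P, 0 < sigma t w ->
     (E t w <= (a t w * excess t w + noise t w)%:E)%E) /\
  ((forall t, \forall w \ae P, 0 < sigma t w) ->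
   forall xi : nat -> Omega -> R,
     (\forall w \ae P, ell1 (xi ^~ w)) ->
     (forall t, \forall w \ae P, noise t w <= xi t w) ->
   forall chi : nat -> R,
     (forall t, 0 <= chi t) ->
     (exists T0 : nat, forall t, (T0 <= t)%N ->
        \forall w \ae P, a t w * chi t.+1 <= chi t) ->
     (\forall w \ae P, ell1 (fun t => chi t.+1 * xi t w)) ->
   \forall w \ae P, exists C : R, 0 < C /\
     forall t, ((excess t w)%:E <= C%:E * ((chi t)%:E)^-1)%E).
Proof.
move=> excess sigma a noise.
have [sF Fm Finc] := HF.
have [Ls0 _] := L_smooth.
have [lam0 PL] := L_PL.
have [CR0 beta0 mbeta retr] := R_contr.
have [cb0 cv10 cv20 bbv] := P_bbv.
have uM t w : M (u t w).
  by case: t => [|t]; [exact: u0_M|rewrite uS; exact: Rt_M].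
have excess0 t w : 0 <= excess t w by rewrite subr_ge0; exact: inf_on_le.
have mexcess t : measurable_wrt (F t) (excess t).
  by apply: measurable_funB => //; exact: Lu_meas.
pose c := (Ls + CR) / 2.
have c0 : 0 <= c by rewrite divr_ge0// addr_ge0// ltW.
pose proj t w := `|orthproj dot (T t w) (g t w)| ^+ 2.
pose res t w := `|g t w - orthproj dot (T t w) (g t w)| ^+ 2.
have descent t : \forall w \ae P, 0 < sigma t w ->
    (E t w <= (a t w * excess t w + noise t w)%:E)%E.
  have [[YD [DYD YDle]] [YQ [QYQ YQle]]] := bbv t _ (g_meas t).
  have step w : excess t.+1 w + s t w * dot (g t w) (Pn t w (g t w)) <=
      excess t w + beta t w + c * s t w ^+ 2 * `|Pn t w (g t w)| ^+ 2.
    have [k Vk] := assoc_dim _ _ (uM t w) (T_assoc t w).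
    have := retracted_step_le (s t w) L_smooth (uM t w) (T_assoc t w) Vk
      (Pn_T t w (g t w)) (retr t w).
    rewrite -gE -uS /excess -/c; lra.
  have := cond_exp_descent (sF t) (Fm t) (mexcess t) (mbeta t) (s_meas t)
    (excess0 t.+1) (excess0 t) (beta0 t) (s_gt0 t) (fun w => sqr_ge0 _) c0 step
    (E_cond t) DYD QYQ YDle YQle.
  apply: filterS => w /le_trans Ew sigma0; apply: Ew; rewrite lee_fin.
  (* With bD = cbias1 |P_t g|^2 and bQ from the variance condition, the terms in
     |P_t g|^2 sum to - sigma |P_t g|^2, to which the condition PL applies
     because sigma is positive. *)
  have := PL _ _ (uM t w) (T_assoc t w).
  rewrite -gE -/(excess t w) -/(proj t w) => PLw.
  have : 0 <= sigma t w * (proj t w - 2 * lam * excess t w).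
    by apply: mulr_ge0; [exact: ltW|rewrite subr_ge0].
  rewrite /a /decay_factor /noise -/(res t w) /sigma /sigma_rate -/c.
  rewrite -/(proj t w).
  lra.
split=> // sigma_gt0 xi xi1 noise_xi chi chi0 achi chixi.
apply: (almost_supermartingale_rate HF mexcess excess0 _ E_cond _ _
  chi0 achi chixi).
- move=> t; apply: measurable_funB => //; apply: measurable_funM => //.
  apply: measurable_funB.
    by apply: measurable_funM => //; exact: s_meas.
  apply: measurable_funM => //; apply: measurable_funM => //.
  by apply: measurable_funX; exact: s_meas.
- move=> t; apply: filterS3 (descent t) (sigma_gt0 t) (noise_xi t).
  move=> w Ele /Ele{}Ele nxi; apply: le_trans Ele _.
  by rewrite lee_fin lerD2l.
- move=> t; apply: filterS (noise_xi t) => w; apply: le_trans.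
  apply: addr_ge0 => //; apply: mulr_ge0; last exact: sqr_ge0.
  by apply: mulr_ge0 => //; apply: mulr_ge0 => //; exact: sqr_ge0.
Qed.
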